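(* Let $p$ be a prime, $k\ge1$, $q=p^k$. Every integer of the form $$D=AB^{q-1},$$ where $A,B\in\mathbb Z$ satisfy $(q-1)^2\mid A$ and $B\equiv A\pmod q$, is an integer group determinant of $GA(1,q)$.
   Context: For a finite group $G=\{g_1,\dots,g_n\}$ and an element $\sum_{g\in G}a_g g$ of the group ring $\mathbb Z[G]$ (all $a_g\in\mathbb Z$), the group determinant is $D\left(\sum_{g\in G}a_g g\right)=\det\left(a_{g_ig_j^{-1}}\right)_{i,j=1}^n$. An integer group determinant of $G$ is any integer of this form. The general affine group of degree one over $\mathbb F_q$ is $GA(1,q)=\left\{\begin{pmatrix} a & b\\ 0 & 1\end{pmatrix}: a\in\mathbb F_q^*,\ b\in\mathbb F_q\right\}$ under matrix multiplication. *)

(* Defs.v *)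
From HB Require Import structures.
From mathcomp Require Import all_boot all_order all_algebra all_fingroup all_field.
Set Implicit Arguments. Unset Strict Implicit. Unset Printing Implicit Defensive.
Import GRing.Theory Num.Theory.
Local Open Scope ring_scope.

Definition group_det (gT : finGroupType) (G : {set gT}) (a : gT -> int) : int :=
  \det (\matrix_(i < #|G|, j < #|G|)
          a ((@enum_val gT (mem G) i) * (@enum_val gT (mem G) j)^-1)%g).

Definition is_int_group_det (gT : finGroupType) (G : {set gT}) (D : int) : Prop :=
  exists a : gT -> int, D = group_det G a.

(* GA(1,F) = { [[a, b], [0, 1]] : a in F^*, b in F } inside GL_2(F). *)
Definition GA1 (F : finFieldType) : {set {'GL_2[F]}} :=
  [set g : {'GL_2[F]} | (GLval g ord_max ord0 == 0) && (GLval g ord_max ord_max == 1)].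

(* Main.v *)
Require Import Defs.
From HB Require Import structures.
From mathcomp Require Import all_boot all_order all_algebra all_fingroup all_field.
From mathcomp Require Import cyclic ring.
Import GRing.Theory Num.Theory.
Local Open Scope ring_scope.

(* Write q = |F|, n = q - 1, A = n^2 m, B = m - q m0 and m1 = m - m0.  Let h be
   a generator of the diagonal subgroup H, y the translation by 1, and S the sum
   of the elements of H in the group ring.  The element
     1 - h + (m0 + m1 y) S y
   has determinant A B^n.  Indeed let P be the 0/1 matrix whose columns are the
   indicators of the q right cosets of H: S acts as P P^T, so the last term is
   a product of a |G| x q and a q x |G| matrix, while 1 - h becomes unitriangular
   after a correction of rank q that opens each h-cycle.  Eliminating
   both updates leaves
     det (P^T (m0 + m1 y) P) * det (P^T y P),
   and these q x q matrices are n m0 I + m1 (J - I) and J - I, with J all ones. *)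

(** * Determinant identities over a commutative ring *)

Section Determinants.
Set Implicit Arguments.
Unset Strict Implicit.
Unset Printing Implicit Defensive.
Variable R : comNzRingType.

(* In the Leibniz formula, a nonzero term can only come from a permutation that
   does not increase [d]; as it preserves the sum of [d], it is the identity. *)
Lemma det_graded_unitriangular (I : finType) (d : I -> nat) (A : 'M[R]_#|I|) :
    (forall i, A i i = 1) ->
    (forall i j, i != j -> A i j != 0 -> (d (enum_val j) < d (enum_val i))%N) ->
  \det A = 1.
Proof.
move=> A1 Alt; rewrite /determinant (bigD1 1%g) //= [X in _ + X]big1 ?addr0.
  by rewrite odd_perm1 mul1r big1 // => i _; rewrite perm1.
move=> s s_n1; have [/existsP[i /eqP Ai0]|] := boolP [exists i, A i (s i) == 0].
  by rewrite (bigD1 i) //= Ai0 mul0r mulr0.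
rewrite negb_exists => /forallP As_n0; case/eqP: s_n1; apply/permP => i.
rewrite perm1; apply/eqP; apply: contraT => si_ni.
have le_s j : (d (enum_val (s j)) <= d (enum_val j))%N.
  by case: (eqVneq (s j) j) => [-> //|sj_nj]; rewrite ltnW // Alt // eq_sym.
have /leqif_sum/= le_sum (j : 'I_#|I|) : true ->
    (d (enum_val (s j)) <= d (enum_val j)
       ?= iff (d (enum_val (s j)) == d (enum_val j)))%N.
  by move=> _; split.
have [_] := le_sum; rewrite [X in _ == X](reindex_perm s) eqxx.
by move=> /esym/forallP/(_ i); rewrite ltn_eqF // Alt // eq_sym.
Qed.

(** Sylvester's identity: two block unitriangular left factors turn the same block matrix into
    triangular ones, each clearing a different off-diagonal block. *)
Lemma det_1mulmxC m n (X : 'M[R]_(m, n)) (Y : 'M[R]_(n, m)) :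
  \det (1%:M + X *m Y) = \det (1%:M + Y *m X).
Proof.
have E : block_mx 1%:M X 0 1%:M *m block_mx 1%:M (- X) Y 1%:M
       = block_mx (1%:M + X *m Y) 0 Y 1%:M.
  by rewrite mulmx_block !(mul1mx, mul0mx, mulmx1, add0r) addNr.
have F : block_mx 1%:M 0 (- Y) 1%:M *m block_mx 1%:M (- X) Y 1%:M
       = block_mx 1%:M (- X) 0 (1%:M + Y *m X).
  rewrite mulmx_block !(mul1mx, mul0mx, mulmx1, add0r, addr0) addNr.
  by rewrite mulNmx mulmxN opprK addrC.
have := congr1 determinant E.
rewrite det_mulmx det_ublock det_lblock !det1 !mul1r mulr1 => <-.
have := congr1 determinant F.
rewrite det_mulmx det_ublock det_lblock !det1 !mul1r => <-.
by [].
Qed.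

Lemma det_block_ul0 n (A B C : 'M[R]_n) :
  \det (block_mx 0 (- A) B C) = \det A * \det B.
Proof.
(* [T *m T' *m T] is the block rotation with rows (0, -1) and (1, 0). It exchanges the column blocks
   up to sign, and its factors visibly have determinant 1. *)
pose T : 'M[R]_(n + n) := block_mx 1%:M (- 1%:M) 0 1%:M.
pose T' : 'M[R]_(n + n) := block_mx 1%:M 0 1%:M 1%:M.
have E : block_mx 0 (- A) B C *m (T *m T' *m T)
       = block_mx (- A) 0 C (- B) *m block_mx 1%:M 0 0 1%:M.
  rewrite /T /T' !mulmx_block !(mul1mx, mul0mx, mulmx1, mulmx0, add0r, addr0).
  by rewrite !(mulmxN, mulNmx, mulmx1, mul1mx, mulmx0, addr0, add0r,
               addNr, subrr, opprK, oppr0).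
have := congr1 determinant E.
rewrite !det_mulmx !det_ublock !det_lblock !det1 !mulr1 => ->.
by rewrite -!scaleN1r !detZ mulrACA -exprMn mulrNN mulr1 expr1n mul1r.
Qed.

(* With [K] the inverse of [M], the condition [Q' K Q = 1] cancels the upper
   left block of the [2n] x [2n] Schur complement. *)
Lemma det_double_update m n (M K : 'M[R]_m) (Q U : 'M[R]_(m, n))
    (Q' W : 'M[R]_(n, m)) :
    M *m K = 1%:M -> Q' *m K *m Q = 1%:M ->
  \det (M - Q *m Q' + U *m W)
    = \det M * (\det (Q' *m K *m U) * \det (W *m K *m Q)).
Proof.
move=> MK1 QKQ1.
have -> : M - Q *m Q' + U *m W
    = M *m (1%:M + row_mx (K *m Q) (K *m U) *m col_mx (- Q') W).
  rewrite mul_row_col mulmxDr mulmx1 mulmxDr !mulmxA MK1 !mul1mx mulmxN.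
  by rewrite addrA.
rewrite det_mulmx det_1mulmxC mul_col_row scalar_mx_block add_block_mx.
rewrite !mulNmx !mulmxA QKQ1 subrr !add0r.
by rewrite det_block_ul0.
Qed.

(** Adding all rows to the first, then subtracting the first column from the others, leaves a lower
    triangular matrix. *)
Lemma det_scalar_const n (a b : R) : (0 < n)%N ->
  \det (a%:M + const_mx b : 'M_n) = (a + b *+ n) * a ^+ n.-1.
Proof.
case: n => // n _ /=.
pose u : 'rV[R]_n := const_mx 1.
have E : block_mx 1%:M u 0 1%:M *m (a%:M + const_mx b : 'M_(1 + n))
            *m block_mx 1%:M (- u) 0 1%:M
       = block_mx (a + b *+ n.+1)%:M 0 (const_mx b) a%:M.
  have -> : (const_mx b : 'M[R]_(1 + n))
      = block_mx (const_mx b) (const_mx b) (const_mx b) (const_mx b).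
    by rewrite -{1}[const_mx b]submxK; congr block_mx; apply/matrixP => i j; rewrite !mxE.
  rewrite scalar_mx_block add_block_mx !add0r !mulmx_block.
  rewrite !(mul1mx, mul0mx, mulmx1, mulmx0, add0r, addr0).
  have uc k : u *m (const_mx b : 'M_(n, k)) = const_mx (b *+ n).
    apply/matrixP => i j; rewrite !mxE; under eq_bigr do rewrite !mxE mul1r.
    by rewrite sumr_const card_ord.
  have cu k c : (const_mx c : 'M_(k, 1)) *m u = const_mx c.
    by apply/matrixP => i j; rewrite !mxE big_ord1 !mxE mulr1.
  rewrite !mulmxDr !uc !mulmxN !mulmxDl !cu mul_scalar_mx mul_mx_scalar.
  congr block_mx; apply/matrixP => i j; rewrite !mxE.
  - by rewrite !ord1 eqxx mulr1n -addrA -mulrS.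
  - by rewrite [b + (_ + _)]addrCA addrA addNr.
  - by rewrite [_ + b]addrC addKr.
have := congr1 determinant E.
by rewrite !det_mulmx !det_ublock det_lblock !det1 !mul1r !mulr1 !det_scalar expr1.
Qed.

(** The two matrices differ by one permutation applied to both rows and columns, so its sign appears
    twice. *)
Lemma det_reindex (X : finType) m m' (f : X -> X -> R)
    (e : 'I_m -> X) (e' : 'I_m' -> X) :
    injective e -> injective e' -> codom e =i codom e' ->
  \det (\matrix_(i, j) f (e i) (e j)) = \det (\matrix_(i, j) f (e' i) (e' j)).
Proof.
move=> inj_e inj_e' ee'.
have eq_m : m' = m.
  rewrite -[LHS]card_ord -[RHS]card_ord -(card_codom inj_e).
  by rewrite -(card_codom inj_e') (eq_card ee').
case: _ / eq_m e inj_e ee' => e inj_e ee'.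
have e'_e i : e' i \in codom e by rewrite ee' codom_f.
pose s i := iinv (e'_e i).
have es i : e (s i) = e' i by rewrite f_iinv.
have inj_s : injective s by move=> i j /(congr1 e); rewrite !es => /inj_e'.
have <- : row_perm (perm inj_s) (col_perm (perm inj_s) (\matrix_(i, j) f (e i) (e j)))
     = \matrix_(i, j) f (e' i) (e' j).
  by apply/matrixP => i j; rewrite !mxE !permE !es.
rewrite row_permE col_permE !det_mulmx !det_perm odd_permV mulrCA.
by rewrite -signr_addb addbb mulr1.
Qed.

Definition finmx (S T : finType) (f : S -> T -> R) : 'M_(#|S|, #|T|) :=
  \matrix_(i, j) f (enum_val i) (enum_val j).

Lemma mul_finmx (S T V : finType) (f : S -> T -> R) (g : T -> V -> R) :
  finmx f *m finmx g = finmx (fun s v => \sum_t f s t * g t v).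
Proof.
apply/matrixP => i j; rewrite !mxE [RHS](reindex _ (onW_bij _ (enum_val_bij T))).
by apply: eq_bigr => k _; rewrite !mxE.
Qed.

Lemma eq_finmx (S T : finType) (f g : S -> T -> R) : f =2 g -> finmx f = finmx g.
Proof. by move=> fg; apply/matrixP => i j; rewrite !mxE fg. Qed.

Lemma scalar_finmx (S : finType) (a : R) : a%:M = finmx (fun s t : S => a *+ (s == t)).
Proof. by apply/matrixP => i j; rewrite !mxE (inj_eq enum_val_inj). Qed.

Lemma det_finmx_diag_const (S : finType) (a b : R) : (0 < #|S|)%N ->
  \det (finmx (fun s t : S => if s == t then a else b))
    = (a - b + b *+ #|S|) * (a - b) ^+ #|S|.-1.
Proof.
move=> S_gt0; rewrite -det_scalar_const //; congr (\det _).
apply/matrixP => i j; rewrite !mxE (inj_eq enum_val_inj).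
by case: eqP => _; rewrite ?add0r ?subrK.
Qed.

Lemma sum_delta (T : finType) (t : T) (f : T -> R) :
  \sum_u (u == t)%:R * f u = f t.
Proof.
rewrite (bigD1 t) //= eqxx mul1r big1 ?addr0 // => u /negPf->.
exact: mul0r.
Qed.

End Determinants.

(** * The affine group over F; here q is [n.+2], and the n of the overview is [n.+1] *)

Section AffineGroup.
Set Implicit Arguments.
Unset Strict Implicit.
Unset Printing Implicit Defensive.
Variables (F : finFieldType) (n : nat) (th : F).
Hypotheses (cardF : #|F| = n.+2) (th_prim : n.+1.-primitive_root th).

Let T := (F * 'I_n.+1)%type.

Lemma thX_neq0 i : th ^+ i != 0.
Proof. by rewrite expf_neq0 ?(prim_root_eq0 th_prim). Qed.

Lemma eq_thX (i j : 'I_n.+1) : (th ^+ i == th ^+ j) = (i == j).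
Proof. by rewrite (eq_prim_root_expr th_prim) !modn_small. Qed.

Lemma nonzero_thX x : x != 0 -> {i : 'I_n.+1 | x = th ^+ i}.
Proof.
move=> x_neq0; apply: (prim_rootP th_prim); apply: (mulfI x_neq0).
by rewrite mulr1 -exprS -cardF expf_card.
Qed.

(** The inverse powers of [th] run once through the nonzero elements. This is why y acts as J - I on
    the cosets. *)
Lemma sum_th_powers (x : F) :
  \sum_(i < n.+1) (x == th ^- i)%:R = (x != 0%R)%:R :> int.
Proof.
have [->|x_neq0] := eqVneq x 0.
  by rewrite big1 // => i _; rewrite eq_sym invr_eq0 (negPf (thX_neq0 i)).
have [|i Ei] := @nonzero_thX x^-1; first by rewrite invr_eq0.
rewrite (bigD1 i) //= -Ei invrK eqxx big1 ?addr0 // => j j_ni.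
apply/eqP; rewrite pnatr_eq0 eqb0; apply: contra_neq j_ni => x_thj.
by move: Ei; rewrite x_thj invrK => /eqP; rewrite eq_thX => /eqP.
Qed.

(* The pair [(x, i)] stands for the affine map [z |-> th^i (z + x)], so that
   [x] indexes the right coset of H and left multiplication by h raises [i]. *)
Definition aff_mx (s : T) : 'M[F]_2 :=
  \matrix_(i, j) if i == ord0 then if j == ord0 then th ^+ s.2 else th ^+ s.2 * s.1
                 else (j != ord0)%:R.

Lemma aff_mxE s :
  (aff_mx s ord0 ord0 = th ^+ s.2) * (aff_mx s ord0 ord_max = th ^+ s.2 * s.1)
  * (aff_mx s ord_max ord0 = 0) * (aff_mx s ord_max ord_max = 1).
Proof. by rewrite !mxE. Qed.

Lemma lift_ord0_2 : lift ord0 ord0 = ord_max :> 'I_2.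
Proof. exact: val_inj. Qed.

Lemma det_affine (A : 'M[F]_2) :
  A ord_max ord0 = 0 -> A ord_max ord_max = 1 -> \det A = A ord0 ord0.
Proof.
move=> A10 A11; rewrite (expand_det_col _ ord0) big_ord_recl big_ord1.
rewrite lift_ord0_2 A10 mul0r addr0 /cofactor det_mx11 !mxE lift_ord0_2 A11.
by rewrite mul1r mulr1.
Qed.

Lemma matrix2P (A B : 'M[F]_2) :
    A ord0 ord0 = B ord0 ord0 -> A ord0 ord_max = B ord0 ord_max ->
    A ord_max ord0 = B ord_max ord0 -> A ord_max ord_max = B ord_max ord_max ->
  A = B.
Proof.
have ord2 (i : 'I_2) : (i = ord0) + (i = ord_max).
  by case: i => [[|[|//]]] ?; [left | right]; apply: val_inj.
by move=> A00 A01 A10 A11; apply/matrixP => i j; case: (ord2 i) (ord2 j) => -> [] ->.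
Qed.

Lemma aff_mx_unit s : aff_mx s \is a GRing.unit.
Proof.
by rewrite unitmxE det_affine !aff_mxE // unitfE thX_neq0.
Qed.

Definition aff (s : T) : {'GL_2[F]} := FinRing.Unit (aff_mx_unit s).

Lemma aff_inj : injective aff.
Proof.
move=> [x i] [y j] /(congr1 GLval) /= E.
have := congr1 (fun A : 'M_2 => A ord0 ord0) E; rewrite !aff_mxE => /eqP.
rewrite eq_thX => /eqP /= ij; move: E; rewrite ij => E.
have := congr1 (fun A : 'M_2 => A ord0 ord_max) E; rewrite !aff_mxE /=.
by move=> /(mulfI (thX_neq0 _)) ->.
Qed.

Lemma aff_GA1 s : aff s \in GA1 F.
Proof. by rewrite inE /= !aff_mxE !eqxx. Qed.

Lemma GA1_aff g : g \in GA1 F -> exists s, g = aff s.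
Proof.
rewrite inE => /andP[/eqP g10 /eqP g11].
have g00 : GLval g ord0 ord0 != 0.
  by rewrite -det_affine // -unitfE -unitmxE; exact: (valP g).
have [i Ei] := nonzero_thX g00.
exists (GLval g ord0 ord_max / th ^+ i, i).
apply: val_inj; apply: matrix2P; rewrite /= !aff_mxE //.
by rewrite mulrC divfK ?thX_neq0.
Qed.

Definition affcoef (g : {'GL_2[F]}) := (GLval g ord0 ord0, GLval g ord0 ord_max).

Lemma affcoef_div s t : affcoef (aff s * (aff t)^-1)
  = (th ^+ s.2 / th ^+ t.2, th ^+ s.2 * (s.1 - t.1)).
Proof.
(* Solving [g * aff t = aff s] for the top row of [g] avoids inverting a matrix. *)
set g := (aff s * _)%g; have /(congr1 GLval) : (g * aff t = aff s)%g by rewrite mulgKV.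
rewrite GL_MxE /= => E.
have e00 := congr1 (fun A : 'M_2 => A ord0 ord0) E.
have e01 := congr1 (fun A : 'M_2 => A ord0 ord_max) E.
move: e00 e01; rewrite ![(_ *m _) _ _]mxE !big_ord_recl !big_ord0.
rewrite lift_ord0_2 !aff_mxE !mulr0 !mulr1 !addr0 /affcoef => <- e01.
rewrite mulfK ?thX_neq0 //; congr (_, _).
by rewrite mulrBr -e01 mulrA addrAC subrr add0r.
Qed.

(* [1 - h], where [h] is deprived of its arrows from [(x, n)] to [(x, 0)]. *)
Definition shift (s t : T) : int :=
  (s == t)%:R - ((t.1 == s.1) && (s.2 == t.2.+1 :> nat))%:R.
(** Writing [shift] as 1 - N with N nilpotent, this is the sum of the powers of N. *)
Definition cum (s t : T) : int := ((t.1 == s.1) && (t.2 <= s.2)%N)%:R.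
(** [first_ind] and [last_ind] factor the rank q correction: subtracting their product from [shift]
    restores 1 - h. *)
Definition first_ind (s : T) (z : F) : int := (s == (z, ord0))%:R.
Definition last_ind (z : F) (t : T) : int := (t == (z, ord_max))%:R.

Lemma shift_cum : finmx shift *m finmx cum = 1%:M.
Proof.
rewrite mul_finmx scalar_finmx; apply: eq_finmx => s t.
under eq_bigr do rewrite /shift mulrBl.
rewrite sumrB; under eq_bigr do rewrite eq_sym; rewrite sum_delta.
rewrite -(pair_bigA _ (fun x (i : 'I_n.+1) =>
  ((x == s.1) && (s.2 == i.+1 :> nat))%:R * cum (x, i) t)) /=.
have -> : \sum_x \sum_(i < n.+1) ((x == s.1) && (s.2 == i.+1 :> nat))%:R * cum (x, i) t
     = \sum_(i < n.+1) (s.2 == i.+1 :> nat)%:R * cum (s.1, i) t.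
  rewrite exchange_big; apply: eq_bigr => i _.
  rewrite -(sum_delta s.1 (fun x => (s.2 == i.+1 :> nat)%:R * cum (x, i) t)).
  by apply: eq_bigr => x _; rewrite -mulnb natrM mulrA.
case: s t => x i [y j]; rewrite /cum /= xpair_eqE [y == x]eq_sym.
have [_|_] /= := eqVneq x y; last first.
  by rewrite big1 ?subr0 // => k _; rewrite mulr0.
(* Index 0 has no predecessor in the opened cycle; elsewhere consecutive rows of [cum] differ only
   on the diagonal. *)
case: i => [[|i] lt_i] /=.
  rewrite big1 => [|k _]; last by rewrite mul0r.
  by rewrite subr0 leqn0 eq_sym.
rewrite (bigD1 (Ordinal (ltnW lt_i))) //= eqxx mul1r big1 ?addr0; last first.
  by move=> k; rewrite -val_eqE /= eqSS eq_sym => /negPf->; rewrite mul0r.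
rewrite -val_eqE /= [(j <= i.+1)%N]leq_eqVlt -[(j <= i)%N]ltnS eq_sym.
by case: ltngtP => _ /=; rewrite ?subr0 ?subrr.
Qed.

Lemma det_shift : \det (finmx shift) = 1.
Proof.
apply: (@det_graded_unitriangular _ _ (fun s : T => s.2 : nat)) => [i | i j ij].
  by rewrite mxE /shift !eqxx eqn_leq ltnn andbF subr0.
rewrite mxE /shift (inj_eq enum_val_inj) (negPf ij) sub0r oppr_eq0 pnatr_eq0 eqb0 negbK.
by case/andP => _ /eqP ->.
Qed.

(** The last row of [cum] in each cycle is full, which gives P^T; dually, its first column gives P
    in [cum_first]. *)
Lemma last_cum : finmx last_ind *m finmx cum = finmx (fun z (t : T) => (t.1 == z)%:R).
Proof.
rewrite mul_finmx; apply: eq_finmx => z t; rewrite sum_delta /cum /=.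
by rewrite -ltnS ltn_ord andbT.
Qed.

Lemma cum_first : finmx cum *m finmx first_ind = finmx (fun (s : T) z => (s.1 == z)%:R).
Proof.
rewrite mul_finmx; apply: eq_finmx => s z; under eq_bigr do rewrite mulrC.
by rewrite sum_delta /cum /= eq_sym leq0n andbT.
Qed.

Lemma last_cum_first : finmx last_ind *m finmx cum *m finmx first_ind = 1%:M.
Proof.
rewrite last_cum mul_finmx scalar_finmx; apply: eq_finmx => z z'.
under eq_bigr do rewrite mulrC.
by rewrite sum_delta eq_sym.
Qed.

(** * The group ring element and its determinant *)

Variables m0 m1 : int.

(* The coefficients of 1 - h + (m0 + m1 y) S y: the elements of S y are the maps
   [z |-> a (z + 1)], and those of y S y are the maps [z |-> a (z + 1) + 1]. *)
Definition gdcoef (g : {'GL_2[F]}) : int :=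
  let: (a, b) := affcoef g in
  ((a == 1) && (b == 0))%:R - ((a == th) && (b == 0))%:R
   + (m0 * (b == a)%:R + m1 * (b == a + 1)%:R).

(** These are (m0 + m1 y) P and P^T y: left multiplication by y sends an element [(x, i)] into the
    coset [x + th ^- i]. *)
Definition left_factor (s : T) (z : F) : int :=
  m0 * (s.1 == z)%:R + m1 * (s.1 - z == th ^- s.2)%:R.
Definition right_factor (z : F) (t : T) : int := (z - t.1 == th ^- t.2)%:R.

Lemma gdcoef_aff s t :
  gdcoef (aff s * (aff t)^-1) = shift s t - first_ind s t.1 * (t.2 == ord_max)%:R
   + left_factor s (t.1 + th ^- t.2).
Proof.
case: s t => x i [y j]; rewrite /gdcoef affcoef_div /left_factor /shift /first_ind /=.
rewrite !xpair_eqE mulf_eq0 (negPf (thX_neq0 _)) /= subr_eq0.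
have E1 : (th ^+ i / th ^+ j == 1) = (i == j).
  by rewrite -[1](divff (thX_neq0 j)) (inj_eq (mulIf _)) ?invr_eq0 ?thX_neq0 ?eq_thX.
(* The second alternative is the wrap-around [th ^+ n.+1 = 1], the arrow missing from [shift]. *)
have E2 : (th ^+ i / th ^+ j == th)
    = ((i == j.+1 :> nat) || ((i == ord0) && (j == ord_max))).
  rewrite -[X in _ == X](mulfK (thX_neq0 j)) (inj_eq (mulIf _)) ?invr_eq0 ?thX_neq0 //.
  rewrite -exprS (eq_prim_root_expr th_prim) modn_small //.
  have [jn|j_nn] := eqVneq j ord_max.
    by rewrite jn modnn andbT orb_idl // => /eqP ini; move: (ltn_ord i); rewrite ini ltnn.
  have lt_jn : (j < n)%N by rewrite ltn_neqAle -ltnS ltn_ord andbT; exact: j_nn.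
  by rewrite andbF orbF modn_small.
have E3 : (th ^+ i * (x - y) == th ^+ i / th ^+ j) = (x == y + th ^- j).
  by rewrite (inj_eq (mulfI (thX_neq0 i))) subr_eq addrC.
have E4 : (th ^+ i * (x - y) == th ^+ i / th ^+ j + 1)
     = (x - (y + th ^- j) == th ^- i).
  rewrite -[in LHS](divff (thX_neq0 i)) -mulrDr (inj_eq (mulfI (thX_neq0 i))).
  by rewrite opprD addrA [RHS]subr_eq [_ + th ^- j]addrC.
rewrite E1 E2 E3 E4 [y == x]eq_sym [(i == j) && _]andbC.
congr (_ + _); rewrite -addrA -opprD; congr (_ - _).
rewrite andbC; case: (x == y) => //=; last by rewrite mul0r addr0.
have [->|i_n0] /= := eqVneq i ord0; first by rewrite mul1r add0r.
by rewrite orbF mul0r addr0.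
Qed.

Lemma first_last : finmx first_ind *m finmx last_ind
  = finmx (fun s t : T => first_ind s t.1 * (t.2 == ord_max)%:R).
Proof.
rewrite mul_finmx; apply: eq_finmx => s [y j].
rewrite -(sum_delta y (fun z => first_ind s z * (j == ord_max)%:R)).
by apply: eq_bigr => z _; rewrite /last_ind xpair_eqE -mulnb natrM mulrCA eq_sym.
Qed.

Lemma left_right : finmx left_factor *m finmx right_factor
  = finmx (fun s t : T => left_factor s (t.1 + th ^- t.2)).
Proof.
rewrite mul_finmx; apply: eq_finmx => s t; rewrite -[RHS]sum_delta.
by apply: eq_bigr => z _; rewrite mulrC /right_factor subr_eq addrC.
Qed.

Lemma det_last_cum_left : \det (finmx last_ind *m finmx cum *m finmx left_factor)
  = n.+1%:R * (m0 + m1) * (m0 *+ n.+1 - m1) ^+ n.+1.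
Proof.
rewrite last_cum mul_finmx.
rewrite (eq_finmx (g := fun z z' => if z == z' then m0 *+ n.+1 else m1)).
  (* Each row sums to [n.+1] times m0 + m1: one diagonal entry and [n.+1] entries m1. *)
  rewrite det_finmx_diag_const cardF //= [m1 *+ n.+2]mulrS addrA subrK.
  by rewrite mulr_natl mulrnDl.
move=> z z'.
rewrite -(pair_bigA _ (fun x (i : 'I_n.+1) => (x == z)%:R * left_factor (x, i) z')) /=.
under eq_bigr do rewrite -mulr_sumr; rewrite sum_delta big_split /=.
rewrite -!mulr_sumr sum_th_powers subr_eq0 sumr_const card_ord.
by case: eqP => _; rewrite ?mulr1 ?mulr0 ?addr0 ?mul0rn ?mulr0 ?add0r // mulrnAr mulr1.
Qed.

Lemma det_right_cum_first : \det (finmx right_factor *m finmx cum *m finmx first_ind)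
  = n.+1%:R * (- 1) ^+ n.+1.
Proof.
rewrite -mulmxA cum_first mul_finmx.
rewrite (eq_finmx (g := fun z z' => if z == z' then 0 else 1)).
  rewrite det_finmx_diag_const cardF //= sub0r [1 *+ n.+2]mulrS addKr; reflexivity.
move=> z z'.
rewrite -(pair_bigA _ (fun x (i : 'I_n.+1) => right_factor z (x, i) * (x == z')%:R)) /=.
under eq_bigr do rewrite -mulr_suml mulrC.
rewrite sum_delta /right_factor /= sum_th_powers subr_eq0.
by case: eqP.
Qed.

Lemma group_det_GA1 : group_det (GA1 F) gdcoef
  = n.+1%:R ^+ 2 * (m0 + m1) * (m1 - m0 *+ n.+1) ^+ n.+1.
Proof.
rewrite /group_det.
rewrite (det_reindex (fun g h => gdcoef (g * h^-1)%g)
  (e' := fun i : 'I_#|{: T}| => aff (enum_val i))).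
- have -> : (\matrix_(i, j) gdcoef (aff (enum_val i) * (aff (enum_val j))^-1)%g) =
     finmx shift - finmx first_ind *m finmx last_ind
     + finmx left_factor *m finmx right_factor.
    rewrite first_last left_right; apply/matrixP => i j; rewrite !mxE /=.
    exact: gdcoef_aff.
  rewrite (det_double_update _ _ shift_cum last_cum_first) det_shift.
  (* The sign from det (J - I) reverses the difference raised to the power [n.+1]. *)
  rewrite det_last_cum_left det_right_cum_first -[m1 - _]opprB [(- (_ - _)) ^+ _]exprNn.
  ring.
- exact: enum_val_inj.
- exact: inj_comp aff_inj enum_val_inj.
move=> g; apply/codomP/codomP => [[i ->]|[i ->]].
  have [s ->] := GA1_aff (enum_valP i).
  by exists (enum_rank s); rewrite /= enum_rankK.
have gG := aff_GA1 (enum_val i).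
by exists (enum_rank_in gG (aff (enum_val i))); rewrite enum_rankK_in.
Qed.

End AffineGroup.

(** * Choice of the parameters from A and B *)

Theorem theorem3 (p k : nat) (F : finFieldType) (A B : int) :
  prime p -> (0 < k)%N -> #|F| = (p ^ k)%N ->
  ((((p ^ k).-1)%:Z ^+ 2) %| A)%Z ->
  (B = A %[mod ((p ^ k)%N)%:Z])%Z ->
  is_int_group_det (GA1 F) (A * B ^+ (p ^ k).-1).
Proof.
move=> _ _ cardF; rewrite -cardF => n2A BA.
have [n Fn] : exists n, #|F| = n.+2.
  by have := finNzRing_gt1 F; case: #|F| => [|[|n]] // _; exists n.
rewrite Fn /= in n2A BA *.
have [th th_prim] : exists th : F, n.+1.-primitive_root th.
  (* The [n.+1] nonzero elements are distinct [n.+1]-th roots of unity, so one of them is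
     primitive. *)
  have /hasP[th _ ?] : has n.+1.-primitive_root [seq x <- enum F | x != 0];
    last by exists th.
  apply: has_prim_root => //; last 2 first.
  - by rewrite filter_uniq ?enum_uniq.
  - rewrite size_filter -ltnS -Fn cardE -(count_predC (pred1 (0 : F)) (enum F)).
    by rewrite (count_uniq_mem _ (enum_uniq F)) mem_enum.
  apply/allP => x; rewrite mem_filter => /andP[x_n0 _]; apply/unity_rootP.
  by apply: (mulfI x_n0); rewrite mulr1 -exprS -Fn expf_card.
have [m Am] := dvdzP n2A.
(* Since (n + 1)^2 = n (n + 2) + 1, A is congruent to m modulo q, hence so is B. *)
have [m0 Bm0] : exists m0 : int, B = m - m0 * n.+2%:Z.
  move/eqP: BA; rewrite eqz_mod_dvd => /dvdzP[c Ec].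
  exists (- c - m * n%:Z); rewrite -[B](subrK A) Ec Am.
  rewrite [Posz n.+1]intS [Posz n.+2]intS [Posz n.+1]intS.
  ring.
exists (gdcoef th m0 (m - m0)); rewrite (group_det_GA1 Fn th_prim) Am Bm0.
rewrite [m0 + _]addrC subrK [m * _]mulrC -[m0 *+ _]mulr_natr !natz [Posz n.+2]intS.
by rewrite mulrDr mulr1 opprD addrA.
Qed.
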